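(* Let $(M,F)$ be a Finsler manifold whose Berwald curvature satisfies, on $TM_0$, $$B^i_{\ jkl}=(\mu_jh_{kl}+\mu_kh_{jl}+\mu_lh_{jk})y^i+\lambda\big(h^i_j h_{kl}+h^i_k h_{jl}+h^i_l h_{jk}\big),$$ where $\mu_i=\mu_i(x,y)$ and $\lambda=\lambda(x,y)$ are positively homogeneous in $y$ of degrees $-2$ and $-1$ respectively. Then the Landsberg curvature vanishes, $\mathbf L=0$, if and only if the mean Landsberg curvature vanishes, $\mathbf J=0$.
   Context: $M$ is an $n$-dimensional $C^\infty$ manifold and $TM_0=TM\setminus\{0\}$ is the slit tangent bundle, with standard local coordinates $(x^i,y^i)$. A Finsler metric $F:TM\to[0,\infty)$ is $C^\infty$ on $TM_0$, positively 1-homogeneous on fibers, and such that $g_{ij}=\frac12\frac{\partial^2 F^2}{\partial y^i\partial y^j}$ is positive definite on $TM_0$. Indices are lowered and raised with $g_{ij}$ and its inverse $g^{ij}$; $y_i=g_{ij}y^j$, $h_{ij}=g_{ij}-F^{-2}y_iy_j$ (angular metric), $h^i_j=\delta^i_j-F^{-2}y^iy_j$. Spray coefficients: $G^i=\frac14 g^{il}\left\{\frac{\partial^2 F^2}{\partial x^k\partial y^l}y^k-\frac{\partial F^2}{\partial x^l}\right\}$. Berwald curvature: $B^i_{\ jkl}=\frac{\partial^3G^i}{\partial y^j\partial y^k\partial y^l}$. Cartan torsion: $C_{ijk}=\frac12\frac{\partial g_{ij}}{\partial y^k}$. Landsberg curvature $\mathbf L$: $L_{ijk}=C_{ijk|s}y^s$.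 Mean Landsberg curvature $\mathbf J$: $J_i=g^{jk}L_{ijk}$. The symbol $|$ denotes the horizontal covariant derivative of the Berwald connection: for a tensor with components $T^i_{\ j}(x,y)$ on $TM_0$ (and similarly for other types), $T^i_{\ j|m}=\frac{\partial T^i_{\ j}}{\partial x^m}-\frac{\partial G^r}{\partial y^m}\frac{\partial T^i_{\ j}}{\partial y^r}+\frac{\partial^2G^i}{\partial y^r\partial y^m}T^r_{\ j}-\frac{\partial^2G^r}{\partial y^j\partial y^m}T^i_{\ r}$. In the assumed form of the Berwald curvature, $\mu_i$ are the components of a covector field along $TM_0$ and $\lambda$ is a scalar function on $TM_0$; since $B^i_{\ jkl}y^j=0$, one has $\mu_iy^i=0$. *)

(* Defs.v *)
(* MathComp-Analysis; the field of real numbers is an arbitrary R : realType. *)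
From HB Require Import structures.
From mathcomp Require Export all_boot all_order all_algebra.
From mathcomp Require Export all_classical all_reals all_analysis.

Set Implicit Arguments.
Unset Strict Implicit.
Unset Printing Implicit Defensive.

Export Order.TTheory GRing.Theory Num.Theory.
Export numFieldNormedType.Exports.

#[global] Open Scope classical_set_scope.
#[global] Open Scope ring_scope.

Definition iter_derive (R : realType) (V W : normedModType R)
    (vs : seq V) (f : V -> W) : V -> W :=
  foldr (fun v (g : V -> W) => 'D_v g) f vs.

(* C^oo on a set A, which is open in every use below: f and all its iterated
   directional derivatives are (Frechet) differentiable at the points of A. *)
Definition smooth_on (R : realType) (V W : normedModType R)
    (A : set V) (f : V -> W) : Prop :=
  forall (vs : seq V) (x : V), A x -> differentiable (iter_derive vs f) x.

(* A homeomorphism from an open subset of M onto an open subset of R^n; the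
   values of chart_map and chart_inv outside these sets are irrelevant. *)
Record chart (R : realType) (n : nat) (M : topologicalType) := Chart {
  chart_dom : set M;
  chart_map :> M -> 'rV[R]_n;
  chart_inv : 'rV[R]_n -> M;
  chart_dom_open : open chart_dom;
  chart_im_open : open (chart_map @` chart_dom);
  chart_mapK : {in chart_dom, cancel chart_map chart_inv};
  chart_map_continuous : {within chart_dom, continuous chart_map};
  chart_inv_continuous :
    {within chart_map @` chart_dom, continuous chart_inv} }.

(* The atlas is not required to be maximal. *)
Record smooth_manifold (R : realType) (n : nat) := SmoothManifold {
  carrier :> topologicalType;
  atlas : set (chart R n carrier);
  manifold_hausdorff : hausdorff_space carrier;
  manifold_second_countable : @second_countable carrier;
  atlas_cover : forall p : carrier, exists2 a, atlas a & chart_dom a p;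
  atlas_smooth : forall a b, atlas a -> atlas b ->
    smooth_on (a @` (chart_dom a `&` chart_dom b)) (b \o chart_inv a) }.

Section TangentBundle.
Context (R : realType) (n : nat) (M : smooth_manifold R n).

Definition chart_at (p : M) (a : chart R n M) : Prop :=
  atlas a /\ chart_dom a p.

(* A tangent vector at p is the family of its coordinate vectors in the charts
   around p, related by the differentials of the transition maps; the value 0
   at all other charts makes this family unique. *)
Definition tvector : Type := chart R n M -> 'rV[R]_n.

Definition tangent_space (p : M) : set tvector :=
  [set v | (forall a, ~ chart_at p a -> v a = 0) /\
           (forall a b, chart_at p a -> chart_at p b ->
              v b = 'd (b \o chart_inv a) (a p) (v a))].

Definition slit_tangent_space (p : M) : set tvector :=
  [set v | tangent_space p v /\ v <> 0].

(* (x, y) in z = (x, y) are the standard coordinates of TM over the chart a;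
   chart_tvector a z is the tangent vector y^i d/dx^i at the point x. *)
Definition chart_tvector (a : chart R n M)
    (z : 'rV[R]_n * 'rV[R]_n) : tvector :=
  fun b => if `[< chart_at (chart_inv a z.1) b >]
           then 'd (b \o chart_inv a) (z.1) (z.2) else 0.

(* The part of the slit tangent bundle over the chart a, in coordinates. *)
Definition chart_slit (a : chart R n M) : set ('rV[R]_n * 'rV[R]_n) :=
  [set z | (a @` chart_dom a) z.1 /\ z.2 <> 0].

(* The local expression of a function on TM or TM_0. *)
Definition in_chart (f : M -> tvector -> R) (a : chart R n M)
    (z : 'rV[R]_n * 'rV[R]_n) : R :=
  f (chart_inv a z.1) (chart_tvector a z).

(* f is defined on the bundle with fibres A p, and c ^ r has r : int. *)
Definition homogeneous_on (A : M -> set tvector) (r : int)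
    (f : M -> tvector -> R) : Prop :=
  forall (p : M) (v : tvector) (c : R),
    A p v -> 0 < c -> f p (c *: v) = c ^ r * f p v.

(* mu p v w is the value at w in T_pM of a covector at p depending on the
   nonzero tangent vector v at p. *)
Definition covector_field (mu : M -> tvector -> tvector -> R) : Prop :=
  forall (p : M) (v u w : tvector) (c : R),
    slit_tangent_space p v -> tangent_space p u -> tangent_space p w ->
    mu p v (c *: u + w) = c * mu p v u + mu p v w.

Definition covector_homogeneous (r : int)
    (mu : M -> tvector -> tvector -> R) : Prop :=
  forall (p : M) (v w : tvector) (c : R),
    slit_tangent_space p v -> tangent_space p w -> 0 < c ->
    mu p (c *: v) w = c ^ r * mu p v w.

Definition covector_comp (mu : M -> tvector -> tvector -> R)
    (a : chart R n M) (i : 'I_n) (z : 'rV[R]_n * 'rV[R]_n) : R :=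
  mu (chart_inv a z.1) (chart_tvector a z)
     (chart_tvector a (z.1, delta_mx 0 i)).

End TangentBundle.

(* F is the expression of a Finsler metric in the coordinates z = (x, y), and
   indices are coordinates: z.2 0 i is y^i. *)
Section LocalTensors.
Context (R : realType) (n : nat).
Notation coords := ('rV[R]_n * 'rV[R]_n)%type.

Definition dx (i : 'I_n) (f : coords -> R) : coords -> R :=
  'D_(delta_mx 0 i, 0) f.
Definition dy (i : 'I_n) (f : coords -> R) : coords -> R :=
  'D_(0, delta_mx 0 i) f.

Context (F : coords -> R).

Definition Fsq (z : coords) : R := F z ^+ 2.

(* fund, fund_inv and ylow are g_ij, g^ij and y_i. *)
Definition fund (i j : 'I_n) (z : coords) : R :=
  2^-1 * dy i (dy j Fsq) z.

Definition fund_inv (i j : 'I_n) (z : coords) : R :=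
  invmx (\matrix_(k, l) fund k l z) i j.

Definition ylow (i : 'I_n) (z : coords) : R :=
  \sum_j fund i j z * z.2 0 j.

Definition angular (i j : 'I_n) (z : coords) : R :=
  fund i j z - (F z) ^- 2 * ylow i z * ylow j z.

(* h^i_j *)
Definition angular_mixed (i j : 'I_n) (z : coords) : R :=
  (i == j)%:R - (F z) ^- 2 * z.2 0 i * ylow j z.

Definition spray (i : 'I_n) (z : coords) : R :=
  4^-1 * \sum_l fund_inv i l z *
    (\sum_k dx k (dy l Fsq) z * z.2 0 k - dx l Fsq z).

(* B^i_jkl *)
Definition berwald (i j k l : 'I_n) (z : coords) : R :=
  dy j (dy k (dy l (spray i))) z.

Definition cartan (i j k : 'I_n) (z : coords) : R :=
  2^-1 * dy k (fund i j) z.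

(* T_ijk|m for a tensor T of type (0,3) *)
Definition hcov (T : 'I_n -> 'I_n -> 'I_n -> coords -> R)
    (i j k m : 'I_n) (z : coords) : R :=
  dx m (T i j k) z
  - \sum_r dy m (spray r) z * dy r (T i j k) z
  - \sum_r dy i (dy m (spray r)) z * T r j k z
  - \sum_r dy j (dy m (spray r)) z * T i r k z
  - \sum_r dy k (dy m (spray r)) z * T i j r z.

Definition landsberg (i j k : 'I_n) (z : coords) : R :=
  \sum_s hcov cartan i j k s z * z.2 0 s.

Definition mean_landsberg (i : 'I_n) (z : coords) : R :=
  \sum_j \sum_k fund_inv j k z * landsberg i j k z.

End LocalTensors.

Record finsler_metric (R : realType) (n : nat) (M : smooth_manifold R n) :=
  FinslerMetric {
  metric :> M -> tvector M -> R;
  metric_ge0 : forall (p : M) (v : tvector M),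
    tangent_space p v -> 0 <= metric p v;
  metric_homogeneous : homogeneous_on (@tangent_space R n M) 1 metric;
  metric_smooth : forall a : chart R n M, atlas a ->
    smooth_on (chart_slit a) (in_chart metric a);
  metric_posdef : forall (a : chart R n M) (z : 'rV[R]_n * 'rV[R]_n)
      (w : 'rV[R]_n), atlas a -> chart_slit a z -> w <> 0 ->
    0 < \sum_i \sum_j fund (in_chart metric a) i j z * w 0 i * w 0 j }.

Definition landsberg_vanishes (R : realType) (n : nat)
    (M : smooth_manifold R n) (F : finsler_metric M) : Prop :=
  forall a z, atlas a -> chart_slit a z ->
  forall i j k, landsberg (in_chart F a) i j k z = 0.

Definition mean_landsberg_vanishes (R : realType) (n : nat)
    (M : smooth_manifold R n) (F : finsler_metric M) : Prop :=
  forall a z, atlas a -> chart_slit a z ->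
  forall i, mean_landsberg (in_chart F a) i z = 0.

(* Main.v *)
From HB Require Import structures.
Require Import Defs.
From mathcomp Require Import perm ring lra.

(* Put E = F^2. The defining equation of the spray, differentiated along the
   fibres, gives dE/dx^m = N^r_m dE/dy^r with N^r_m = dG^r/dy^m. Differentiating
   this three more times in y and contracting with y^m (G is 2-homogeneous)
   yields L_jkl = - 1/2 y_r B^r_jkl. For the given form of B, y_r h^r_j = 0 and
   y_r y^r = F^2 leave
     L_jkl = - 1/2 F^2 (mu_j h_kl + mu_k h_jl + mu_l h_jk),
   whose trace is J_i = - 1/2 F^2 ((n + 1) mu_i - 2 F^-2 (mu_r y^r) y_i).
   If J = 0, contracting with y^i gives (n - 1) mu_r y^r = 0, so mu = 0 when
   n <> 1, while h = 0 when n = 1; in both cases L = 0. *)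

Set Implicit Arguments.
Unset Strict Implicit.
Unset Printing Implicit Defensive.

(** The relation $dE/dx^m=N^r_m\,dE/dy^r$ comes from using the spray equation twice: contracted with
    $y$ it says that $E$ is constant along the spray, and the $y^m$-derivative of that statement,
    compared with the spray equation of index $m$, leaves twice the relation. The homogeneity of $G$
    is itself derived, from that of $E$ and the nondegeneracy of its fibre Hessian. Up to four fibre
    derivatives of $E$ and of $G$ have to be permuted freely. The analytic burden is therefore the
    symmetry of second derivatives and the smoothness of $G$, which contains the inverse matrix
    $g^{ij}$. The identities themselves are proved for abstract commuting derivations, where only
    indices and degrees matter; everything about $h$ and $\mu$ is linear algebra at one fixed
    tangent vector. *)

Lemma near_eq_differentiable (R : realType) (V W : normedModType R)
    (f g : V -> W) (x : V) :
  (\forall y \near x, f y = g y) -> differentiable f x -> differentiable g x.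
Proof.
move=> fg df.
have fgx : g x = f x by rewrite (nbhs_singleton fg).
(* A first-order expansion with continuous linear part determines the differential, so it is enough
   that the expansion of [f] at [x] holds for [g]. *)
suff gE : g \o shift x = cst (g x) + 'd f x +o_ 0 id.
  have dg := diff_unique (diff_continuous df) gE.
  by apply/diff_locallyP; rewrite dg; split => //; exact: diff_continuous.
apply/eqaddoP => e e0.
have /eqaddoP/(_ e e0) := diff_locally df.
have fg0 : \forall h \near 0, f (h + x) = g (h + x).
  by move: fg; rewrite (near_shift 0 x) subr0.
apply: filterS2 fg0 => h fgh.
by rewrite /= fgx/= !fctE /= fgh.
Qed.

(** * Smooth functions on an open set: closure properties and symmetry of second derivatives *)

Section Smooth.
Context (R : realType) (V : normedModType R) (U : set V) (Uo : open U).
Implicit Types f g : V -> R.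

Lemma near_eq_on f g x : {in U, f =1 g} -> U x -> \forall y \near x, f y = g y.
Proof.
move=> fg Ux; have := open_nbhs_nbhs (conj Uo Ux).
by apply: filterS => y Uy; rewrite fg ?inE.
Qed.

Lemma derive_on f g v x : {in U, f =1 g} -> U x -> 'D_v f x = 'D_v g x.
Proof. by move=> fg Ux; apply: near_eq_derive; exact: near_eq_on. Qed.

Lemma iter_derive_on f g vs : {in U, f =1 g} ->
  {in U, iter_derive vs f =1 iter_derive vs g}.
Proof.
move=> fg; elim: vs => //= v vs ih x; rewrite inE => Ux.
exact: derive_on.
Qed.

Lemma smooth_ext f g : {in U, f =1 g} -> smooth_on U f -> smooth_on U g.
Proof.
move=> fg sf vs x Ux; apply: near_eq_differentiable (sf vs x Ux).
by apply: near_eq_on => //; exact: iter_derive_on.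
Qed.

Lemma smooth_derive f v : smooth_on U f -> smooth_on U ('D_v f).
Proof.
move=> sf vs x Ux; have := sf (rcons vs v) x Ux.
by rewrite /iter_derive -cats1 foldr_cat.
Qed.

Lemma smooth_diff f x : smooth_on U f -> U x -> differentiable f x.
Proof. by move=> sf Ux; exact: sf [::] x Ux. Qed.

Lemma smooth_derivable f x v : smooth_on U f -> U x -> derivable f x v.
Proof. by move=> sf Ux; apply: diff_derivable; exact: smooth_diff. Qed.

(** Smoothness graded by the number of derivatives, peeling off the one applied first. The sum,
    product and quotient rules then close by induction on [k] over all functions at once, although
    they do not preserve the shape of a single [iter_derive]. *)
Fixpoint ndiff k f : Prop :=
  if k is k'.+1 then
    (forall x, U x -> differentiable f x) /\ forall v, ndiff k' ('D_v f)
  else True.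

Lemma smoothP f : smooth_on U f <-> forall k, ndiff k f.
Proof.
split=> [sf k|nf vs].
  elim: k f sf => //= k ih f sf; split=> [x Ux|v]; first exact: smooth_diff.
  by apply: ih; exact: smooth_derive.
elim/last_ind: vs f nf => [|vs v ih] f nf x Ux; first by case: (nf 1%N) => + _; exact.
rewrite /iter_derive -cats1 foldr_cat /=.
by apply: (ih ('D_v f)) => // k; have [_] := nf k.+1; exact.
Qed.

Lemma ndiff_ext k f g : {in U, f =1 g} -> ndiff k f -> ndiff k g.
Proof.
elim: k f g => //= k ih f g fg [df nf]; split=> [x Ux|v].
  by apply: near_eq_differentiable (df x Ux); exact: near_eq_on.
by apply: ih (nf v) => x; rewrite inE => Ux; exact: derive_on.
Qed.

Lemma ndiffW k f : ndiff k.+1 f -> ndiff k f.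
Proof.
elim: k f => // k ih f [df nf]; split => // v; apply: ih; exact: nf.
Qed.

Lemma ndiffD k f g : ndiff k f -> ndiff k g -> ndiff k (f + g).
Proof.
elim: k f g => //= k ih f g [df nf] [dg ng]; split=> [x Ux|v].
  by apply: differentiableD; [exact: df|exact: dg].
apply: ndiff_ext (ih _ _ (nf v) (ng v)) => x; rewrite inE => Ux.
by rewrite deriveD//; apply: diff_derivable; [exact: df|exact: dg].
Qed.

Lemma ndiffM k f g : ndiff k f -> ndiff k g -> ndiff k (f * g).
Proof.
elim: k f g => //= k ih f g [df nf] [dg ng]; split=> [x Ux|v].
  by apply: differentiableM; [exact: df|exact: dg].
have nf' : ndiff k f by exact: ndiffW (conj df nf).
have ng' : ndiff k g by exact: ndiffW (conj dg ng).
have := ndiffD (ih _ _ nf' (ng v)) (ih _ _ ng' (nf v)).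
apply: ndiff_ext => x; rewrite inE => Ux.
by rewrite deriveM//; apply: diff_derivable; [exact: df|exact: dg].
Qed.

Lemma smoothD f g : smooth_on U f -> smooth_on U g -> smooth_on U (f + g).
Proof. by move=> /smoothP sf /smoothP sg; apply/smoothP => k; exact: ndiffD. Qed.

Lemma smoothM f g : smooth_on U f -> smooth_on U g -> smooth_on U (f * g).
Proof. by move=> /smoothP sf /smoothP sg; apply/smoothP => k; exact: ndiffM. Qed.

Lemma smooth_cst c : smooth_on U (cst c : V -> R).
Proof.
apply/smoothP => k; elim: k c => //= k ih c; split=> [x Ux|v] //.
rewrite (_ : 'D_v _ = cst 0) //.
by apply/funext => x; rewrite derive_cst.
Qed.

(** The derivative of $1/f$ is $-f'/f^2$, a product of $f'$ and copies of $1/f$, so [k] derivatives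
    of $1/f$ yield one more. *)
Lemma smooth_inv f : smooth_on U f -> (forall x, U x -> f x != 0) ->
  smooth_on U (fun x => (f x)^-1).
Proof.
move=> sf f0; apply/smoothP; elim => //= k ih; split=> [x Ux|v].
  by apply: differentiableV; [exact: smooth_diff|exact: f0].
have nf : ndiff k ('D_v f) by move: k {ih}; apply/smoothP; exact: smooth_derive.
have nc : ndiff k (cst (-1)) by move: k {ih nf}; apply/smoothP; exact: smooth_cst.
apply: ndiff_ext (ndiffM nc (ndiffM (ndiffM ih ih) nf)) => x; rewrite inE => Ux.
rewrite deriveV //; [|exact: f0|exact: smooth_derivable].
by rewrite !fctE /= expr2 invfM mulN1r scaleNr.
Qed.

Lemma smooth_sum (I : Type) (r : seq I) (P : pred I) (f : I -> V -> R) :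
  (forall i, smooth_on U (f i)) ->
  smooth_on U (fun x => \sum_(i <- r | P i) f i x).
Proof.
move=> sf; rewrite (_ : (fun x => _) = \sum_(i <- r | P i) f i); last first.
  by apply/funext => x; rewrite fct_sumE.
by elim/big_rec: _ => [|i g _ sg]; [exact: smooth_cst|exact: smoothD].
Qed.

Lemma smooth_prod (I : Type) (r : seq I) (P : pred I) (f : I -> V -> R) :
  (forall i, smooth_on U (f i)) ->
  smooth_on U (fun x => \prod_(i <- r | P i) f i x).
Proof.
move=> sf; elim: r => [|i r ih].
  by apply: smooth_ext (smooth_cst 1) => x _; rewrite big_nil.
have [Pi|Pi] := boolP (P i).
  by apply: smooth_ext (smoothM (sf i) ih) => x _; rewrite big_cons Pi.
by apply: smooth_ext ih => x _; rewrite big_cons (negbTE Pi).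
Qed.

Lemma derive_sumM (n : nat) (f g : 'I_n -> V -> R) v x :
  (forall i, smooth_on U (f i)) -> (forall i, smooth_on U (g i)) -> U x ->
  'D_v (fun y => \sum_i f i y * g i y) x =
  \sum_i ('D_v (f i) x * g i x + f i x * 'D_v (g i) x).
Proof.
move=> sf sg Ux.
rewrite (_ : (fun y => _) = \sum_i (f i * g i)); last first.
  by apply/funext => y; rewrite fct_sumE.
rewrite derive_sum; last first.
  by move=> i; apply: derivableM; exact: smooth_derivable.
apply: eq_bigr => i _.
rewrite deriveM; [|exact: smooth_derivable..].
by rewrite addrC; congr (_ + _); rewrite mulrC.
Qed.

Lemma is_derive_line f x u (s : R) : derivable f (x + s *: u) u ->
  is_derive s 1 (fun t => f (x + t *: u)) ('D_u f (x + s *: u)).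
Proof.
have E : (fun h : R => h^-1 *: (((fun t => f (x + t *: u)) \o shift s) (h *: 1)
                                - f (x + s *: u)))
       = (fun h : R => h^-1 *: ((f \o shift (x + s *: u)) (h *: u)
                                - f (x + s *: u))).
  apply/funext => h /=; congr (_ *: (f _ - _)).
  by rewrite [h%:A]mulr1 scalerDl addrCA.
move=> df; apply: DeriveDef; first by rewrite /derivable E.
by rewrite /derive E.
Qed.

(** The mean value theorem applied twice: along [u] to the increment [phi] of [f] over [h *: v],
    then along [v] to the derivative of [f] in direction [u]. *)
Lemma second_difference f u v x (h : R) : smooth_on U f -> 0 < h ->
  (forall s t, s \in `[0, h] -> t \in `[0, h] -> U (x + s *: u + t *: v)) ->
  exists s t, [/\ s \in `[0, h], t \in `[0, h] &
    f (x + h *: u + h *: v) - f (x + h *: u) - (f (x + h *: v) - f x)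
    = h ^+ 2 * 'D_v ('D_u f) (x + s *: u + t *: v)].
Proof.
move=> sf h0 Uh.
have sub (t : R) : t \in `]0, h[ -> t \in `[0, h] by exact: subset_itv_oo_cc.
have h00 : 0 \in `[0, h] by rewrite in_itv /= lexx ltW.
have hh : h \in `[0, h] by rewrite in_itv /= lexx ltW.
pose phi s := f (x + h *: v + s *: u) - f (x + s *: u).
pose dphi s := 'D_u f (x + h *: v + s *: u) - 'D_u f (x + s *: u).
have Uh0 s : s \in `[0, h] -> U (x + s *: u).
  by move=> /(Uh s 0)/(_ h00); rewrite scale0r addr0.
have Uhh s : s \in `[0, h] -> U (x + h *: v + s *: u).
  by move=> /(Uh s h)/(_ hh); rewrite addrAC.
have dphiP s : s \in `[0, h] -> is_derive s 1 phi (dphi s).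
  move=> sh; apply: is_deriveB; apply: is_derive_line; apply: smooth_derivable => //.
    exact: Uhh.
  exact: Uh0.
have [|s /sub sh] := @MVT R phi dphi 0 h h0 (fun s si => dphiP s (sub s si)).
  by apply: derivable_within_continuous => s /dphiP [].
rewrite subr0 {1}/phi {1}/phi !scale0r !addr0 [x + h *: v + _]addrAC => phiE.
pose psi t := 'D_u f (x + s *: u + t *: v).
have psiP t : t \in `[0, h] -> is_derive t 1 psi ('D_v ('D_u f) (x + s *: u + t *: v)).
  move=> th; apply: is_derive_line; apply: smooth_derivable.
    exact: smooth_derive.
  exact: Uh.
have [|t /sub th] := @MVT R psi _ 0 h h0 (fun s si => psiP s (sub s si)).
  by apply: derivable_within_continuous => t /psiP [].
rewrite subr0 /psi scale0r addr0 => psiE.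
exists s, t; split => //.
by rewrite phiE /dphi [x + h *: v + _]addrAC psiE expr2 -mulrA mulrC.
Qed.

(* By the mean value theorem, the second difference over a small parallelogram
   is a value of either mixed derivative nearby; both are continuous at x. *)
Lemma schwarz f u v x : smooth_on U f -> U x ->
  'D_u ('D_v f) x = 'D_v ('D_u f) x.
Proof.
move=> sf Ux; apply/eqP/negPn/negP => neq.
pose A := 'D_u ('D_v f) x; pose B := 'D_v ('D_u f) x.
pose e := `|A - B| / 2.
have e0 : 0 < e by rewrite divr_gt0 // normr_gt0 subr_eq0.
have cont w1 w2 : {for x, continuous ('D_w1 ('D_w2 f))}.
  apply: differentiable_continuous; apply: smooth_diff => //.
  by do 2!apply: smooth_derive.
have nA : \forall y \near x, `|A - 'D_u ('D_v f) y| < e.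
  exact: (cvgr_dist_lt _ _ (cont u v) e e0).
have nB : \forall y \near x, `|B - 'D_v ('D_u f) y| < e.
  exact: (cvgr_dist_lt _ _ (cont v u) e e0).
clearbody A B.
have /nbhs_ballP[d /= d0 dP] : \forall y \near x, [/\ U y,
    `|A - 'D_u ('D_v f) y| < e & `|B - 'D_v ('D_u f) y| < e].
  have nU : \forall y \near x, U y by exact: open_nbhs_nbhs.
  by apply: filterS3 nU nA nB => y; split.
(* The summand 1 makes [N] positive and the bound $h(|u|+|v|)<hN=d$ strict. *)
pose N := `|u| + `|v| + 1.
have N0 : 0 < N by rewrite ltr_wpDl ?addr_ge0.
pose h := d / N.
have h0 : 0 < h by rewrite divr_gt0.
have ballP s t : s \in `[0, h] -> t \in `[0, h] -> ball x d (x + s *: u + t *: v).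
  rewrite !in_itv /= => /andP[s0 sh] /andP[t0 th].
  rewrite -ball_normE /= opprD addrA opprD addrA subrr sub0r -opprD normrN.
  apply: (le_lt_trans (ler_normD _ _)); rewrite !normrZ !ger0_norm //.
  have -> : d = h * N by rewrite divfK ?gt_eqF.
  rewrite /N !mulrDr mulr1 ltr_pwDr // lerD // ler_wpM2r //.
have [|s [t [sh th E1]]] := @second_difference f u v x h sf h0.
  by move=> s t sh th; case: (dP _ (ballP s t sh th)).
have [|t' [s' [th' sh' E2]]] := @second_difference f v u x h sf h0.
  by move=> t2 s2 th2 sh2; rewrite addrAC; case: (dP _ (ballP s2 t2 sh2 th2)).
have [_ _ B1] := dP _ (ballP _ _ sh th).
have [_ + _] := dP _ (ballP _ _ sh' th'); rewrite addrAC => A1.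
move: E1 E2 A1 B1; rewrite (addrAC x (h *: v)).
move: ('D_v ('D_u f) _) => P; move: ('D_u ('D_v f) _) => Q.
move: (f _) (f _) (f _) (f _) => f1 f2 f3 f4 E1 E2 A1 B1.
have PQ : P = Q.
  apply: (mulfI (x := h ^+ 2)); first by rewrite expf_neq0 ?gt_eqF.
  rewrite -E1 -E2; ring.
have : `|A - B| < e + e.
  apply: le_lt_trans (ltrD A1 B1); rewrite (distrC B) PQ; exact: ler_distD.
by rewrite -splitr ltxx.
Qed.

End Smooth.

(** * Fibre coordinates and derivatives along the fibres *)

Section Fibres.
Context (R : realType) (n : nat).
Notation coords := ('rV[R]_n * 'rV[R]_n)%type.
Context (U : set coords) (Uo : open U).
Implicit Types (f g : coords -> R) (z : coords).

Lemma diff_fibre_coord (i : 'I_n) z :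
  differentiable (fun z : coords => z.2 0 i) z /\
  forall v, 'D_v (fun z : coords => z.2 0 i) z = v.2 0 i.
Proof.
have l1 : linear (fun z : coords => z.2 0 i).
  by move=> c u v /=; rewrite !mxE.
pose L := HB.pack_for {linear coords -> R} (fun z : coords => z.2 0 i)
    (GRing.isLinear.Build _ _ _ _ _ l1).
have cL : continuous L.
  move=> w; apply: (@continuous_comp _ _ _ snd (fun y : 'rV[R]_n => y 0 i)).
    exact: cvg_snd.
  exact: coord_continuous.
have dL : differentiable L z by exact: linear_differentiable.
split => // v; rewrite -[LHS]/('D_v L z) deriveE // diff_lin //.
Qed.

Lemma smooth_fibre_coord i : smooth_on U (fun z : coords => z.2 0 i).
Proof.
move=> vs z _; case/lastP: vs => [|vs v]; first by case: (diff_fibre_coord i z).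
rewrite /iter_derive -cats1 foldr_cat /=.
rewrite (_ : 'D_v _ = cst (v.2 0 i)); last first.
  by apply/funext => x; case: (diff_fibre_coord i x).
by apply: (@smooth_cst _ _ setT) => //; exact: openT.
Qed.

Lemma derive_fibre_coord i v z : 'D_v (fun z : coords => z.2 0 i) z = v.2 0 i.
Proof. by case: (diff_fibre_coord i z). Qed.

(** For [w] equal to [z.2] this turns the Euler operator $y^i\partial/\partial y^i$ into the radial
    derivative. *)
Lemma derive_fibre f z (w : 'rV[R]_n) : smooth_on U f -> U z ->
  \sum_i w 0 i * dy i f z = 'D_(0, w) f z.
Proof.
move=> sf Uz; have df := smooth_diff sf Uz.
rewrite deriveE // [in RHS](row_sum_delta w).
rewrite (_ : (0, _) = \sum_i w 0 i *: ((0, delta_mx 0 i) : coords)); last first.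
  rewrite [RHS]surjective_pairing; congr pair.
    by rewrite (raddf_sum fst) big1 //= => i _; rewrite scaler0.
  by rewrite (raddf_sum snd).
rewrite linear_sum; apply: eq_bigr => i _.
by rewrite linearZ /dy deriveE.
Qed.

Lemma deriveCM c f v z : smooth_on U f -> U z ->
  'D_v (fun y => c * f y) z = c * 'D_v f z.
Proof.
move=> sf Uz; rewrite -[LHS]/('D_v (c \*: f) z) deriveZ //.
exact: (smooth_derivable sf).
Qed.

End Fibres.

(** * From the spray equation to the Landsberg curvature, by formal differentiation *)

(* D (inl i) and D (inr i) stand for d/dx^i and d/dy^i, and S for the smooth
   functions on U; only the formal properties of these derivations are used. *)
Section SprayIdentities.
Context (R : realType) (T : Type) (n : nat) (U : set T) (S : set (T -> R)).
Context (D : 'I_n + 'I_n -> (T -> R) -> T -> R) (y : 'I_n -> T -> R).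
Local Notation X i := (D (inl i)).
Local Notation Y i := (D (inr i)).
Context (S_D : forall a f, S f -> S (D a f)) (S_y : forall i, S (y i)).
Context (D_ext : forall a f g z,
  (forall z, U z -> f z = g z) -> U z -> D a f z = D a g z).
Context (D_lin : forall a (c : R) f g z, S f -> S g -> U z ->
  D a (fun z => c * f z + g z) z = c * D a f z + D a g z).
Context (S_lin : forall (c : R) f g, S f -> S g -> S (fun z => c * f z + g z)).
Context (D_sum : forall a (f g : 'I_n -> T -> R) z,
  (forall i, S (f i)) -> (forall i, S (g i)) -> U z ->
  D a (fun z => \sum_i f i z * g i z) z =
  \sum_i (D a (f i) z * g i z + f i z * D a (g i) z)).
Context (S_sum : forall (f g : 'I_n -> T -> R),
  (forall i, S (f i)) -> (forall i, S (g i)) ->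
  S (fun z => \sum_i f i z * g i z)).
Context (DC : forall a b f z, S f -> U z -> D a (D b f) z = D b (D a f) z).
Context (X_y : forall i j z, X i (y j) z = 0).
Context (Y_y : forall i j z, Y i (y j) z = (i == j)%:R).

(** Euler's identity, the infinitesimal form of homogeneity of degree [r] along the fibres. *)
Definition euler r f := forall z, U z -> \sum_i y i z * Y i f z = r * f z.

Lemma D_Z a c f z : S f -> U z -> D a (fun z => c * f z) z = c * D a f z.
Proof.
(* Linearity is available for $cf+g$; writing $cf=(c-1)f+f$ avoids the zero function. *)
move=> sf Uz; rewrite -[RHS](subrK (D a f z)) -{2}[D a f z]mul1r -mulrBl -D_lin //.
by apply: D_ext => // w _; rewrite mulrBl mul1r subrK.
Qed.

Lemma D_add a f g z : S f -> S g -> U z ->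
  D a (fun z => f z + g z) z = D a f z + D a g z.
Proof.
move=> sf sg Uz; rewrite -[D a f z]mul1r -D_lin //.
by apply: D_ext => // w _; rewrite mul1r.
Qed.

Lemma S_add f g : S f -> S g -> S (fun z => f z + g z).
Proof.
move=> sf sg; have := S_lin 1 sf sg; congr (S _).
by apply/funext => z; rewrite mul1r.
Qed.

Lemma D_ySum a (f : 'I_n -> T -> R) z : (forall i, S (f i)) -> U z ->
  D a (fun z => \sum_i y i z * f i z) z =
  (if a is inr j then f j z else 0) + \sum_i y i z * D a (f i) z.
Proof.
move=> sf Uz; rewrite D_sum // big_split /=; congr (_ + _); case: a => j.
  by rewrite big1 // => i _; rewrite X_y mul0r.
rewrite (bigD1 j) //= Y_y eqxx mul1r big1 ?addr0 // => i ij.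
by rewrite Y_y eq_sym (negbTE ij) mul0r.
Qed.

(** Euler's identity is differentiated and the derivatives commuted; $\partial/\partial y^j$ also
    hits the coefficient $y^j$, which costs one degree. *)
Lemma euler_D a r f : S f -> euler r f ->
  euler (if a is inr _ then r - 1 else r) (D a f).
Proof.
move=> sf ef z Uz.
have := D_ext a ef Uz; rewrite D_ySum ?D_Z //; last by move=> i; apply: S_D.
have -> : \sum_i y i z * D a (Y i f) z = \sum_i y i z * Y i (D a f) z.
  by apply: eq_bigr => i _; rewrite DC.
case: a => j; first by rewrite add0r.
by rewrite mulrBl mul1r => <-; rewrite addrAC subrr add0r.
Qed.

Lemma euler_sum (f g : 'I_n -> T -> R) z : (forall i, S (f i)) -> (forall i, S (g i)) ->
  U z ->
  \sum_i y i z * Y i (fun z => \sum_l f l z * g l z) z =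
  \sum_l ((\sum_i y i z * Y i (f l) z) * g l z + f l z * \sum_i y i z * Y i (g l) z).
Proof.
move=> sf sg Uz.
under eq_bigr => i _ do rewrite D_sum // mulr_sumr.
rewrite exchange_big; apply: eq_bigr => l _ /=.
rewrite mulr_suml mulr_sumr -big_split; apply: eq_bigr => i _ /=; ring.
Qed.

Context (E : T -> R) (G : 'I_n -> T -> R).
Context (sE : S E) (sG : forall i, S (G i)).
Context (eE : euler 2 E).
Context (nondeg : forall z (w : 'I_n -> R), U z ->
  (forall i, \sum_j Y i (Y j E) z * w j = 0) -> forall i, w i = 0).
(** The definition of $G^i$ with the inverse metric cleared: the Hessian of $E$ is $2g_{il}$, so the
    left side is $4g_{il}G^l$. *)
Context (sprayE : forall i z, U z ->
  2 * \sum_l Y i (Y l E) z * G l z = \sum_k y k z * X k (Y i E) z - X i E z).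

Lemma euler_y i : euler 1 (y i).
Proof.
move=> z Uz; rewrite (bigD1 i) //= Y_y eqxx mulr1 mul1r big1 ?addr0 // => j ji.
by rewrite Y_y (negbTE ji) mulr0.
Qed.

(** In the spray equation the Hessian of $E$ has degree 0 and the right side degree 2. Applying
    $y^j\partial/\partial y^j$ shows that the Hessian kills the vector $y^j\partial G^l/\partial
    y^j-2G^l$, and nondegeneracy makes it zero. *)
Lemma euler_spray i : euler 2 (G i).
Proof.
move=> z Uz.
have S2 a b : S (D a (D b E)) by do 2!apply: S_D.
have S1 a : S (D a E) by apply: S_D.
apply/eqP; rewrite -subr_eq0; apply/eqP.
apply: (nondeg (w := fun i => \sum_k y k z * Y k (G i) z - 2 * G i z) Uz) => {}i.
have eH l : \sum_k y k z * Y k (Y i (Y l E)) z = 0.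
  have := euler_D (inr i) (S1 (inr l)) (euler_D (inr l) sE eE) Uz => /= ->.
  by rewrite (_ : 2 - 1 - 1 = 0 :> R) ?mul0r //; ring.
have eX k : \sum_j y j z * Y j (X k (Y i E)) z = X k (Y i E) z.
  have := euler_D (inl k) (S1 (inr i)) (euler_D (inr i) sE eE) Uz => /= ->.
  by rewrite (_ : 2 - 1 = 1 :> R) ?mul1r //; ring.
have eX0 : \sum_j y j z * Y j (X i E) z = 2 * X i E z.
  exact: (euler_D (inl i) sE eE Uz).
have L : \sum_j y j z * Y j (fun z => 2 * \sum_l Y i (Y l E) z * G l z) z =
    2 * \sum_l Y i (Y l E) z * \sum_j y j z * Y j (G l) z.
  transitivity (2 * \sum_j y j z * Y j (fun z => \sum_l Y i (Y l E) z * G l z) z).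
    rewrite mulr_sumr; apply: eq_bigr => j _; rewrite D_Z //; last exact: S_sum.
    by rewrite mulrCA.
  rewrite euler_sum //; congr (_ * _); apply: eq_bigr => l _.
  by rewrite eH mul0r add0r.
have Rr : \sum_j y j z * Y j (fun z => \sum_k y k z * X k (Y i E) z - X i E z) z =
    2 * (\sum_k y k z * X k (Y i E) z - X i E z).
  transitivity (\sum_j y j z * Y j (fun z => \sum_k y k z * X k (Y i E) z) z -
                \sum_j y j z * Y j (X i E) z).
    rewrite -sumrB; apply: eq_bigr => j _; rewrite -mulrBr; congr (_ * _).
    rewrite -[RHS]addrC -mulN1r -D_lin //; last exact: S_sum.
    by apply: D_ext => // w _; rewrite addrC mulN1r.
  rewrite euler_sum // eX0 mulrBr; congr (_ - _).
  rewrite mulr_sumr; apply: eq_bigr => k _.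
  by rewrite euler_y // eX mul1r; ring.
have : \sum_j y j z * Y j (fun z => 2 * \sum_l Y i (Y l E) z * G l z) z =
    \sum_j y j z * Y j (fun z => \sum_k y k z * X k (Y i E) z - X i E z) z.
  by apply: eq_bigr => j _; congr (_ * _); apply: D_ext => // w Uw; exact: sprayE.
rewrite L Rr -sprayE // => /eqP.
rewrite -subr_eq0 -mulrBr mulf_eq0 pnatr_eq0 /= => /eqP eq0.
rewrite -[RHS]eq0 mulr_sumr -sumrB; apply: eq_bigr => l _; ring.
Qed.

(** The spray equation contracted with $y^i$: on the left $y^iE_{il}=\partial E/\partial y^l$, on
    the right the degrees of $\partial E/\partial y^i$ and $E$ leave $2-1$ copies of $y^k\,\partial
    E/\partial x^k$. *)
Lemma spray_energy z : U z -> \sum_k y k z * X k E z = 2 * \sum_r G r z * Y r E z.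
Proof.
move=> Uz.
have S1 a : S (D a E) by apply: S_D.
have e1 l : \sum_i y i z * Y i (Y l E) z = Y l E z.
  have := euler_D (inr l) sE eE Uz => /= ->.
  by rewrite (_ : 2 - 1 = 1 :> R) ?mul1r //; ring.
have eX k : \sum_i y i z * X k (Y i E) z = 2 * X k E z.
  rewrite -[RHS](euler_D (inl k) sE eE Uz); apply: eq_bigr => i _.
  by rewrite DC.
have : \sum_i y i z * (2 * \sum_l Y i (Y l E) z * G l z) =
       \sum_i y i z * (\sum_k y k z * X k (Y i E) z - X i E z).
  by apply: eq_bigr => i _; rewrite sprayE.
under [RHS]eq_bigr => i _ do rewrite mulrBr mulr_sumr.
rewrite [RHS]sumrB exchange_big /=.
under [Z in Z - _]eq_bigr => k _.
  under eq_bigr => i _ do rewrite mulrCA.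
  rewrite -mulr_sumr eX.
  over.
rewrite -sumrB => H; transitivity (\sum_i (y i z * (2 * X i E z) - y i z * X i E z)).
  by apply: eq_bigr => i _; ring.
rewrite -H.
under eq_bigr => i _ do rewrite mulrCA mulr_sumr.
rewrite -mulr_sumr exchange_big /=; congr (_ * _); apply: eq_bigr => l _.
rewrite -e1 mulr_sumr; apply: eq_bigr => i _; ring.
Qed.

(* The energy is constant along the horizontal fields d/dx^m - N^r_m d/dy^r. *)
Lemma horizontal_energy m z : U z -> X m E z = \sum_r Y m (G r) z * Y r E z.
Proof.
move=> Uz.
have S1 a : S (D a E) by apply: S_D.
have := D_ext (inr m) spray_energy Uz.
rewrite D_ySum // D_Z //; last exact: S_sum.
rewrite D_sum // big_split /= mulrDr.
have -> : \sum_i y i z * Y m (X i E) z = \sum_i y i z * X i (Y m E) z.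
  by apply: eq_bigr => i _; rewrite DC.
have -> : \sum_i G i z * Y m (Y i E) z = \sum_i Y m (Y i E) z * G i z.
  by apply: eq_bigr => i _; rewrite mulrC.
rewrite sprayE //; lra.
Qed.

(* 4 C_jkl *)
Let E3 j k l : T -> R := Y l (Y j (Y k E)).

(** Each further fibre derivative doubles the number of sums. Derivatives stay in the order in which
    they arise; the terms are matched only in [spray_landsberg]. *)
Lemma horizontal_energy1 k m z : U z -> X m (Y k E) z =
  \sum_r Y k (Y m (G r)) z * Y r E z + \sum_r Y m (G r) z * Y k (Y r E) z.
Proof.
move=> Uz; rewrite DC //; rewrite (D_ext _ (horizontal_energy m)) //.
by rewrite D_sum ?big_split //; move=> *; repeat apply: S_D.
Qed.

Lemma horizontal_energy2 j k m z : U z -> X m (Y j (Y k E)) z =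
  \sum_r Y j (Y k (Y m (G r))) z * Y r E z
  + \sum_r Y k (Y m (G r)) z * Y j (Y r E) z
  + (\sum_r Y j (Y m (G r)) z * Y k (Y r E) z
     + \sum_r Y m (G r) z * Y j (Y k (Y r E)) z).
Proof.
move=> Uz; rewrite DC //; last exact: S_D.
rewrite (D_ext _ (horizontal_energy1 k m)) // D_add //;
  [|by apply: S_sum => *; repeat apply: S_D..].
by rewrite !D_sum ?big_split //; move=> *; repeat apply: S_D.
Qed.

Lemma horizontal_energy3 j k l m z : U z -> X m (E3 j k l) z =
  \sum_r Y l (Y j (Y k (Y m (G r)))) z * Y r E z
  + \sum_r Y j (Y k (Y m (G r))) z * Y l (Y r E) z
  + (\sum_r Y l (Y k (Y m (G r))) z * Y j (Y r E) z
     + \sum_r Y k (Y m (G r)) z * Y l (Y j (Y r E)) z)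
  + (\sum_r Y l (Y j (Y m (G r))) z * Y k (Y r E) z
     + \sum_r Y j (Y m (G r)) z * Y l (Y k (Y r E)) z
     + (\sum_r Y l (Y m (G r)) z * Y j (Y k (Y r E)) z
       + \sum_r Y m (G r) z * Y l (Y j (Y k (Y r E))) z)).
Proof.
move=> Uz; rewrite /E3 DC //; last by repeat apply: S_D.
rewrite (D_ext _ (horizontal_energy2 j k m)) //.
rewrite !D_add //; try by (repeat apply: S_add); apply: S_sum => *; repeat apply: S_D.
by rewrite !D_sum ?big_split //; move=> *; repeat apply: S_D.
Qed.

(** Of the eight sums in [horizontal_energy3], the four with at most two derivatives of $G$ cancel
    the correction terms of the covariant derivative. Contraction with $y^m$ kills the three with
    third derivatives of $G$, since second derivatives have degree 0; third derivatives have degree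
    $-1$, so the fourth-order sum survives with the minus sign. *)
Lemma spray_landsberg j k l z : U z ->
  \sum_m (X m (E3 j k l) z - \sum_r Y m (G r) z * Y r (E3 j k l) z
    - \sum_r Y j (Y m (G r)) z * E3 r k l z
    - \sum_r Y k (Y m (G r)) z * E3 j r l z
    - \sum_r Y l (Y m (G r)) z * E3 j k r z) * y m z =
  - \sum_r Y r E z * Y l (Y j (Y k (G r))) z.
Proof.
move=> Uz.
have S1 a : S (D a E) by apply: S_D.
have S2 a b : S (D a (D b E)) by apply: S_D.
have S3 a b c : S (D a (D b (D c E))) by apply: S_D.
have DC2 a b c w : U w -> D a (D b (D c E)) w = D a (D c (D b E)) w.
  by move=> Uw; apply: D_ext => // w' Uw'; exact: DC.
have DC3 a b c d : D a (D b (D c (D d E))) z = D a (D b (D d (D c E))) z.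
  by apply: D_ext => // w' Uw'; exact: DC2.
have E4 r : Y l (Y j (Y k (Y r E))) z = Y r (E3 j k l) z.
  rewrite DC3 (D_ext (g := Y r (Y j (Y k E))) (inr l)) //; last by move=> *; exact: DC.
  exact: DC.
have C1 r : Y l (Y k (Y r E)) z = E3 r k l z by rewrite DC2.
have C2 r : Y j (Y k (Y r E)) z = E3 j k r z.
  by rewrite DC2 // [LHS]DC.
have SG1 r a : S (D a (G r)) by apply: S_D.
have SG2 r a b : S (D a (D b (G r))) by apply: S_D.
have eG1 r a : euler 1 (Y a (G r)).
  have := euler_D (inr a) (sG r) (euler_spray r) => /=.
  by rewrite (_ : 2 - 1 = 1 :> R) //; ring.
have eG2 r a b : euler 0 (Y a (Y b (G r))).
  by have := euler_D (inr a) (SG1 r (inr b)) (eG1 r b); rewrite subrr.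
have eG3 r a b c : euler (-1) (Y a (Y b (Y c (G r)))).
  by have := euler_D (inr a) (SG2 r (inr b) (inr c)) (eG2 r b c); rewrite sub0r.
have N2 r a b : \sum_m y m z * Y a (Y b (Y m (G r))) z = 0.
  rewrite -[RHS](mul0r (Y a (Y b (G r)) z)) -eG2 //.
  apply: eq_bigr => m _; congr (_ * _).
  rewrite (D_ext (g := Y m (Y b (G r))) (inr a)) //; last by move=> *; exact: DC.
  exact: DC.
have N3 r : \sum_m y m z * Y l (Y j (Y k (Y m (G r)))) z = - Y l (Y j (Y k (G r))) z.
  rewrite -[RHS]mulN1r -eG3 //.
  apply: eq_bigr => m _; congr (_ * _).
  rewrite -[RHS]DC //; apply: D_ext => // w Uw.
  rewrite -[RHS]DC //; apply: D_ext => // w' Uw'.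
  exact: DC.
transitivity (\sum_m \sum_r (y m z * Y l (Y j (Y k (Y m (G r)))) z * Y r E z
  + y m z * Y j (Y k (Y m (G r))) z * Y l (Y r E) z
  + y m z * Y l (Y k (Y m (G r))) z * Y j (Y r E) z
  + y m z * Y l (Y j (Y m (G r))) z * Y k (Y r E) z)).
  apply: eq_bigr => m _; rewrite horizontal_energy3 //.
  under [\sum_r Y m (G r) z * Y l _ z]eq_bigr => r _ do rewrite E4.
  under [\sum_r Y j (Y m (G r)) z * Y l _ z]eq_bigr => r _ do rewrite C1.
  under [\sum_r Y l (Y m (G r)) z * Y j _ z]eq_bigr => r _ do rewrite C2.
  rewrite !big_split /=.
  have P (f g : 'I_n -> R) :
      \sum_r y m z * f r * g r = y m z * \sum_r f r * g r.
    by rewrite mulr_sumr; apply: eq_bigr => r _; rewrite mulrA.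
  rewrite !P /E3; ring.
rewrite exchange_big -sumrN; apply: eq_bigr => r _ /=.
by rewrite !big_split /= -!mulr_suml !N2 N3 !mul0r !addr0 mulNr mulrC.
Qed.

End SprayIdentities.

(** * Finsler tensors in local coordinates *)

Lemma smooth_det (R : realType) (V : normedModType R) (U : set V) (Uo : open U)
    m (A : V -> 'M[R]_m) : (forall i j, smooth_on U (fun z => A z i j)) ->
  smooth_on U (fun z => \det (A z)).
Proof.
move=> sA; apply: smooth_sum => // s.
have sP := smooth_prod Uo (index_enum _) xpredT (fun i => sA i (s i)).
exact: (smoothM Uo (smooth_cst ((-1) ^+ s)) sP).
Qed.

(** Serves to replace $C_{ijk}$ by third derivatives of $F^2$. The hypotheses concern one point
    because the proportionality is known only on the open set where $F$ is smooth. *)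
Lemma hcov_scale (R : realType) (n : nat) (F : 'rV[R]_n * 'rV[R]_n -> R)
    (T T' : 'I_n -> 'I_n -> 'I_n -> 'rV[R]_n * 'rV[R]_n -> R) (c : R) z :
  (forall i j k, T i j k z = c * T' i j k z) ->
  (forall m i j k, dx m (T i j k) z = c * dx m (T' i j k) z) ->
  (forall m i j k, dy m (T i j k) z = c * dy m (T' i j k) z) ->
  forall i j k m, hcov F T i j k m z = c * hcov F T' i j k m z.
Proof.
move=> TT' dxT dyT i j k m; rewrite /hcov dxT !mulrBr !mulr_sumr.
by congr (_ - _ - _ - _ - _); apply: eq_bigr => r _; rewrite ?dyT ?TT' mulrCA.
Qed.

Section LocalFinsler.
Context (R : realType) (n : nat).
Notation coords := ('rV[R]_n * 'rV[R]_n)%type.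
Context (U : set coords) (Uo : open U) (F : coords -> R).
Context (sF : smooth_on U F).
Context (posdef : forall z (w : 'rV[R]_n), U z -> w <> 0 ->
  0 < \sum_i \sum_j fund F i j z * w 0 i * w 0 j).
Context (euler_metric : forall z, U z ->
  \sum_i z.2 0 i * dy i (Fsq F) z = 2 * Fsq F z).

Let dir (a : 'I_n + 'I_n) : coords :=
  match a with inl i => (delta_mx 0 i, 0) | inr i => (0, delta_mx 0 i) end.
Let D a (f : coords -> R) : coords -> R := 'D_(dir a) f.
Let y i (z : coords) : R := z.2 0 i.

Let S_D a f : smooth_on U f -> smooth_on U (D a f).
Proof. exact: smooth_derive. Qed.

Let S_y i : smooth_on U (y i). Proof. exact: smooth_fibre_coord. Qed.

Let D_ext a f g z : (forall z, U z -> f z = g z) -> U z -> D a f z = D a g z.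
Proof. by move=> fg Uz; apply: (derive_on Uo) => // w; rewrite inE; exact: fg. Qed.

Let S_lin (c : R) (f g : coords -> R) : smooth_on U f -> smooth_on U g ->
  smooth_on U (fun z => c * f z + g z).
Proof.
move=> sf sg; apply: (smoothD Uo (f := fun z => c * f z)) sg.
exact: (smoothM Uo (smooth_cst c)).
Qed.

Let D_lin a (c : R) f g z : smooth_on U f -> smooth_on U g -> U z ->
  D a (fun z => c * f z + g z) z = c * D a f z + D a g z.
Proof.
move=> sf sg Uz; rewrite /D -(deriveCM c _ sf) //.
rewrite -[LHS]/('D_(dir a) ((fun z => c * f z) + g) z) deriveD //.
  apply: (@smooth_derivable _ _ U) => //.
  exact: (smoothM Uo (smooth_cst c)).
exact: (smooth_derivable sg).
Qed.

Let D_sum a (f g : 'I_n -> coords -> R) z :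
  (forall i, smooth_on U (f i)) -> (forall i, smooth_on U (g i)) -> U z ->
  D a (fun z => \sum_i f i z * g i z) z =
  \sum_i (D a (f i) z * g i z + f i z * D a (g i) z).
Proof. by move=> sf sg Uz; exact: derive_sumM sf sg Uz. Qed.

Let S_sum (f g : 'I_n -> coords -> R) :
  (forall i, smooth_on U (f i)) -> (forall i, smooth_on U (g i)) ->
  smooth_on U (fun z => \sum_i f i z * g i z).
Proof.
move=> sf sg; apply: (smooth_sum Uo) => i; exact: (smoothM Uo (sf i) (sg i)).
Qed.

Let DC a b f z : smooth_on U f -> U z -> D a (D b f) z = D b (D a f) z.
Proof. exact: schwarz. Qed.

Let X_y i j z : D (inl i) (y j) z = 0.
Proof. by rewrite /D derive_fibre_coord mxE. Qed.

Let Y_y i j z : D (inr i) (y j) z = (i == j)%:R.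
Proof. by rewrite /D derive_fibre_coord mxE eqxx eq_sym. Qed.

Let E := Fsq F.

Let sE : smooth_on U E.
Proof.
by apply: smooth_ext (smoothM Uo sF sF).
Qed.

Let sfund i j : smooth_on U (fund F i j).
Proof. exact: (smoothM Uo (smooth_cst 2^-1) (S_D (inr i) (S_D (inr j) sE))). Qed.

Let M z : 'M[R]_n := \matrix_(k, l) fund F k l z.

Lemma fund_unit z : U z -> M z \in unitmx.
Proof.
move=> Uz; rewrite unitmxE unitfE; apply/negP => /det0P[v v0 vM].
have := posdef Uz (elimN eqP v0); rewrite exchange_big /= big1 ?ltxx // => j _.
have vMj : \sum_i fund F i j z * v 0 i = 0.
  move/matrixP/(_ 0 j): vM; rewrite !mxE => vMj; rewrite -[RHS]vMj.
  by apply: eq_bigr => i _; rewrite mxE mulrC.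
by rewrite -mulr_suml vMj mul0r.
Qed.

Lemma fund_invE i k z : U z -> \sum_j fund F i j z * fund_inv F j k z = (i == k)%:R.
Proof.
move=> Uz; have /matrixP/(_ i k) := mulmxV (fund_unit Uz); rewrite !mxE => <-.
by apply: eq_bigr => j _; rewrite mxE.
Qed.

Lemma fund_invE' i k z : U z -> \sum_j fund_inv F i j z * fund F j k z = (i == k)%:R.
Proof.
move=> Uz; have /matrixP/(_ i k) := mulVmx (fund_unit Uz); rewrite !mxE => <-.
by apply: eq_bigr => j _; rewrite [M z _ _]mxE.
Qed.

(** By Cramer's formula $g^{ij}$ is, on [U], a cofactor divided by a nonvanishing determinant, and
    determinants are polynomial in the entries. *)
Let sfund_inv i j : smooth_on U (fund_inv F i j).
Proof.
have sM k l : smooth_on U (fun z => M z k l).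
  by apply: smooth_ext (sfund k l) => // z _; rewrite mxE.
pose f z := (\det (M z))^-1; pose g z := (-1) ^+ (j + i) * \det (row' j (col' i (M z))).
apply: (@smooth_ext _ _ _ Uo (f * g)).
  move=> z; rewrite inE => Uz; rewrite /fund_inv -/(M z) /invmx fund_unit // !mxE.
  by [].
apply: (smoothM Uo); last first.
  apply: (smoothM Uo (smooth_cst _)); apply: (smooth_det Uo) => k l.
  by apply: smooth_ext (sM (lift j k) (lift i l)) => // z _; rewrite !mxE.
apply: (smooth_inv Uo (f := fun z => \det (M z))); first exact: smooth_det.
by move=> z Uz; rewrite -unitfE -unitmxE fund_unit.
Qed.

Let sG i : smooth_on U (spray F i).
Proof.
apply: (smoothM Uo (smooth_cst _)); apply: S_sum => // l.
apply: (smooth_ext Uo (f := fun z => -1 * dx l E z + \sum_k dx k (dy l E) z * y k z)).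
  by move=> z _ /=; rewrite addrC mulN1r.
apply: S_lin; first exact: (S_D (inl l)).
by apply: S_sum => // k; exact: (S_D (inl k) (S_D (inr l) sE)).
Qed.

Let dyC i j z : U z -> dy i (dy j E) z = dy j (dy i E) z.
Proof. exact: (schwarz Uo _ _ sE). Qed.

Let dyyE i l z : dy i (dy l E) z = 2 * fund F i l z.
Proof. by rewrite /fund mulrA divff ?mul1r // pnatr_eq0. Qed.

Let sprayE i z : U z ->
  2 * \sum_l dy i (dy l E) z * spray F l z = \sum_k y k z * dx k (dy i E) z - dx i E z.
Proof.
move=> Uz; pose r m := \sum_k dx k (dy m E) z * z.2 0 k - dx m E z.
transitivity (\sum_m (\sum_l fund F i l z * fund_inv F l m z) * r m).
  under [RHS]eq_bigr => m _ do rewrite mulr_suml.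
  rewrite exchange_big mulr_sumr; apply: eq_bigr => l _ /=.
  rewrite /spray dyyE -/E mulrA mulrA mulr_sumr mulr_sumr.
  apply: eq_bigr => m _; by rewrite -/(r m); field.
rewrite (bigD1 i) //= fund_invE // eqxx mul1r big1 ?addr0; last first.
  by move=> m mi; rewrite fund_invE // eq_sym (negbTE mi) mul0r.
by congr (_ - _); apply: eq_bigr => k _; rewrite mulrC.
Qed.

Let nondeg z (w : 'I_n -> R) : U z ->
  (forall i, \sum_j dy i (dy j E) z * w j = 0) -> forall i, w i = 0.
Proof.
move=> Uz Hw i; apply: contrapT => wi.
have /(posdef Uz) : \row_j w j <> 0 by move=> /rowP/(_ i); rewrite !mxE.
rewrite big1 ?ltxx // => k _.
transitivity (2^-1 * w k * \sum_j dy k (dy j E) z * w j); last by rewrite Hw mulr0.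
rewrite mulr_sumr; apply: eq_bigr => j _; by rewrite !mxE dyyE; field.
Qed.

Let eE : euler U D y 2 E. Proof. exact: euler_metric. Qed.

(** Euler's identity for $\partial E/\partial y^i$, which has degree 1. *)
Lemma ylowE i z : U z -> ylow F i z = 2^-1 * dy i E z.
Proof.
move=> Uz; have := euler_D S_D S_y D_ext D_lin D_sum DC X_y Y_y (inr i) sE eE Uz.
rewrite (_ : 2 - 1 = 1 :> R) ?mul1r; last by ring.
rewrite /D /= => e1.
transitivity (2^-1 * \sum_j y j z * dy j (dy i E) z); last by congr (_ * _).
rewrite mulr_sumr; apply: eq_bigr => j _.
have fE : fund F i j z = 2^-1 * dy i (dy j E) z by [].
rewrite fE -mulrA (dyC _ _ Uz).
by rewrite [_ * z.2 0 j]mulrC.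
Qed.

Lemma fund_sym i j z : U z -> fund F i j z = fund F j i z.
Proof. by move=> Uz; rewrite /fund (dyC i j Uz). Qed.

Lemma ylow_contract z : U z -> \sum_i z.2 0 i * ylow F i z = Fsq F z.
Proof.
move=> Uz; transitivity (2^-1 * \sum_i z.2 0 i * dy i E z).
  by rewrite mulr_sumr; apply: eq_bigr => i _; rewrite ylowE // mulrCA.
by rewrite euler_metric // mulrA mulVf ?mul1r // pnatr_eq0.
Qed.

(** The constant: $C_{jkl}$ is a quarter of a third derivative of $E$, and $\partial E/\partial
    y^r=2y_r$, so the sum in [spray_landsberg] acquires $-\frac14\cdot2$. *)
Lemma landsbergE j k l z : U z ->
  landsberg F j k l z = - 2^-1 * \sum_r ylow F r z * berwald F r l j k z.
Proof.
move=> Uz.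
pose C a b c : coords -> R := dy c (dy a (dy b E)).
have sC a b c : smooth_on U (C a b c).
  exact: (S_D (inr c) (S_D (inr a) (S_D (inr b) sE))).
have cartanE a b c w : U w -> cartan F a b c w = 4^-1 * C a b c w.
  move=> Uw.
  have dfund : dy c (fund F a b) w = 2^-1 * C a b c w.
    exact: (deriveCM _ _ (S_D (inr a) (S_D (inr b) sE)) Uw).
  by rewrite /cartan dfund mulrA; congr (_ * _); field.
transitivity (4^-1 * \sum_m hcov F C j k l m z * y m z).
  rewrite mulr_sumr; apply: eq_bigr => m _; rewrite mulrA; congr (_ * _).
  apply: hcov_scale => [a b c|i a b c|i a b c]; first exact: cartanE.
    rewrite -[RHS](deriveCM (4^-1) (dir (inl i)) (sC a b c) Uz).
    by apply: (D_ext (inl i)) => // w Uw; exact: cartanE.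
  rewrite -[RHS](deriveCM (4^-1) (dir (inr i)) (sC a b c) Uz).
  by apply: (D_ext (inr i)) => // w Uw; exact: cartanE.
have -> : \sum_m hcov F C j k l m z * y m z =
    - \sum_r dy r E z * dy l (dy j (dy k (spray F r))) z.
  exact: (spray_landsberg S_D S_y D_ext D_lin S_lin D_sum S_sum DC X_y Y_y sE sG eE
    nondeg sprayE).
rewrite mulrN mulNr mulr_sumr mulr_sumr; congr (- _); apply: eq_bigr => r _.
have bE : berwald F r l j k z = dy l (dy j (dy k (spray F r))) z by [].
rewrite bE ylowE // mulrA mulrA; congr (_ * _).
by rewrite mulrA; congr (_ * _); field.
Qed.

End LocalFinsler.

(** * Linear algebra of the angular metric at one tangent vector *)

Section AngularForm.
Context (R : realFieldType) (n : nat) (g gi h hm : 'I_n -> 'I_n -> R).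
Context (y yl m : 'I_n -> R) (q : R).
Context (g_sym : forall i j, g i j = g j i)
  (giE : forall i k, \sum_j gi i j * g j k = (i == k)%:R)
  (gE : forall i k, \sum_j g i j * gi j k = (i == k)%:R)
  (ylE : forall i, yl i = \sum_j g i j * y j)
  (qE : \sum_i y i * yl i = q) (q0 : q != 0)
  (hE : forall i j, h i j = g i j - q^-1 * yl i * yl j)
  (hmE : forall i j, hm i j = (i == j)%:R - q^-1 * y i * yl j).

Let delta_suml (f : 'I_n -> R) i : \sum_j (i == j)%:R * f j = f i.
Proof.
rewrite (bigD1 i) //= eqxx mul1r big1 ?addr0 // => j ji.
by rewrite eq_sym (negbTE ji) mul0r.
Qed.

Let delta_sumr (f : 'I_n -> R) i : \sum_j f j * (j == i)%:R = f i.
Proof.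
by rewrite -[RHS]delta_suml; apply: eq_bigr => j _; rewrite mulrC eq_sym.
Qed.

Lemma angular_mixed_contract j : \sum_r yl r * hm r j = 0.
Proof.
transitivity (\sum_r (yl r * (r == j)%:R - q^-1 * yl j * (y r * yl r))).
  by apply: eq_bigr => r _; rewrite hmE; ring.
by rewrite sumrB delta_sumr -mulr_sumr qE; field.
Qed.

(** Every [lam] term carries a factor $y_rh^r_s$ and dies. The indices stand in the order [l], [j],
    [k] produced by [landsbergE]. *)
Lemma angular_form_contract lam j k l :
  \sum_r yl r * ((m l * h j k + m j * h l k + m k * h l j) * y r
    + lam * (hm r l * h j k + hm r j * h l k + hm r k * h l j)) =
  q * (m l * h j k + m j * h l k + m k * h l j).
Proof.
transitivity (\sum_r ((m l * h j k + m j * h l k + m k * h l j) * (y r * yl r)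
  + lam * (yl r * hm r l * h j k + yl r * hm r j * h l k + yl r * hm r k * h l j))).
  by apply: eq_bigr => r _; ring.
rewrite big_split /= -!mulr_sumr qE !big_split /= -!mulr_suml.
by rewrite !angular_mixed_contract; ring.
Qed.

Lemma raise_ylow i : \sum_k gi i k * yl k = y i.
Proof.
under eq_bigr => k _ do rewrite ylE mulr_sumr.
rewrite exchange_big /= -[RHS]delta_suml; apply: eq_bigr => j _.
by rewrite -giE mulr_suml; apply: eq_bigr => k _; rewrite mulrA.
Qed.

(** Symmetry is assumed of [g] only, so contraction in the first index of [gi] goes through the
    other inverse identity. *)
Lemma raise_ylow' k : \sum_j yl j * gi j k = y k.
Proof.
under eq_bigr => j _ do rewrite ylE mulr_suml.
rewrite exchange_big /= -[RHS]delta_sumr; apply: eq_bigr => i _.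
rewrite -gE mulr_sumr; apply: eq_bigr => j _.
by rewrite (g_sym j i); ring.
Qed.

(** In dimension one, where $y$ has a single nonzero coordinate, this forces $h=0$. *)
Lemma angular_kernel i : \sum_j h i j * y j = 0.
Proof.
transitivity (\sum_j (g i j * y j - q^-1 * yl i * (y j * yl j))).
  by apply: eq_bigr => j _; rewrite hE; ring.
by rewrite sumrB -ylE -mulr_sumr qE; field.
Qed.

Lemma raise_angular i j : \sum_k gi j k * h k i = (j == i)%:R - q^-1 * y j * yl i.
Proof.
transitivity (\sum_k (gi j k * g k i - q^-1 * yl i * (gi j k * yl k))).
  by apply: eq_bigr => k _; rewrite hE; ring.
by rewrite sumrB giE -mulr_sumr raise_ylow; ring.
Qed.

Lemma raise_angular' i k : \sum_j h i j * gi j k = (i == k)%:R - q^-1 * yl i * y k.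
Proof.
transitivity (\sum_j (g i j * gi j k - q^-1 * yl i * (yl j * gi j k))).
  by apply: eq_bigr => j _; rewrite hE; ring.
by rewrite sumrB gE -mulr_sumr raise_ylow'; ring.
Qed.

Let s := \sum_j m j * y j.

(** The trace of $h$ gives $n-1$ copies of $m_i$. Each of the other two terms projects $m$ off $y$,
    adding one copy of $m_i$ and subtracting $q^{-1}s\,y_i$. *)
Lemma trace_angular_form i :
  \sum_j \sum_k gi j k * (m k * h i j + m i * h k j + m j * h k i) =
  (n%:R + 1) * m i - 2 * q^-1 * s * yl i.
Proof.
transitivity (\sum_k (\sum_j h i j * gi j k) * m k
  + m i * \sum_j \sum_k gi j k * h k j + \sum_j m j * \sum_k gi j k * h k i).
  transitivity (\sum_j \sum_k h i j * gi j k * m k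
      + m i * \sum_j \sum_k gi j k * h k j + \sum_j m j * \sum_k gi j k * h k i).
    rewrite mulr_sumr -!big_split; apply: eq_bigr => j _ /=.
    rewrite !mulr_sumr -!big_split; apply: eq_bigr => k _ /=; ring.
  congr (_ + _ + _); rewrite exchange_big; apply: eq_bigr => k _ /=.
  by rewrite mulr_suml.
have -> : \sum_k (\sum_j h i j * gi j k) * m k = m i - q^-1 * yl i * s.
  transitivity (\sum_k ((i == k)%:R * m k - q^-1 * yl i * (m k * y k))).
    by apply: eq_bigr => k _; rewrite raise_angular'; ring.
  by rewrite sumrB delta_suml -mulr_sumr.
have -> : \sum_j m j * \sum_k gi j k * h k i = m i - q^-1 * yl i * s.
  transitivity (\sum_j (m j * (j == i)%:R - q^-1 * yl i * (m j * y j))).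
    by apply: eq_bigr => j _; rewrite raise_angular; ring.
  by rewrite sumrB delta_sumr -mulr_sumr.
have -> : \sum_j \sum_k gi j k * h k j = n%:R - 1.
  transitivity (\sum_j (1 - q^-1 * (y j * yl j))).
    by apply: eq_bigr => j _; rewrite raise_angular eqxx mulrA.
  by rewrite sumrB -mulr_sumr qE mulVf // sumr_const card_ord.
ring.
Qed.

Lemma angular_form_eq0 :
  (forall i, \sum_j \sum_k gi j k * (m k * h i j + m i * h k j + m j * h k i) = 0) ->
  forall j k l, m l * h j k + m j * h l k + m k * h l j = 0.
Proof.
move=> tr0 j k l.
have tr i : (n%:R + 1) * m i = 2 * q^-1 * s * yl i.
  by apply/eqP; rewrite -subr_eq0 -trace_angular_form tr0.
have [n1|n1] := eqVneq n 1%N.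
  have ordE (i : 'I_n) : i = j.
    apply: ord_inj; have := ltn_ord i; have := ltn_ord j.
    by rewrite [X in (_ < X)%N -> (_ < X)%N -> _]n1 !ltnS !leqn0 => /eqP-> /eqP->.
  have y0 : y j != 0.
    apply: contra_neq q0 => yj; rewrite -qE big1 // => i _.
    by rewrite (ordE i) yj mul0r.
  have h0 a b : h a b = 0.
    have := angular_kernel a; rewrite (bigD1 j) //= big1 ?addr0; last first.
      by move=> i; rewrite (ordE i) eqxx.
    by move=> /eqP; rewrite mulf_eq0 (negbTE y0) orbF (ordE b) => /eqP.
  by rewrite !h0 !mulr0 !addr0.
have s0 : s = 0.
  have : \sum_i y i * ((n%:R + 1) * m i) = \sum_i y i * (2 * q^-1 * s * yl i).
    by apply: eq_bigr => i _; rewrite tr.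
  have -> : \sum_i y i * ((n%:R + 1) * m i) = (n%:R + 1) * s.
    by rewrite mulr_sumr; apply: eq_bigr => i _; ring.
  have -> : \sum_i y i * (2 * q^-1 * s * yl i) = 2 * s.
    have lin c : \sum_i y i * (c * yl i) = c * \sum_i y i * yl i.
      by rewrite mulr_sumr; apply: eq_bigr => i _; ring.
    by rewrite lin qE; field.
  move=> /eqP; rewrite -subr_eq0 -mulrBl mulf_eq0 => /orP[|/eqP //].
  by rewrite opprD addrA addrK subr_eq0 pnatr_eq1 (negbTE n1).
have m0 i : m i = 0.
  have /eqP := tr i; rewrite s0 mulr0 mul0r mulf_eq0 => /orP[|/eqP //].
  by rewrite natr1 pnatr_eq0.
by rewrite !m0 !mul0r !addr0.
Qed.

End AngularForm.

(** * Charts, tangent vectors and Euler's identity for $F^2$ *)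

Lemma near_diff_comp (R : realType) (V1 V2 V3 : normedModType R)
    (f : V1 -> V2) (g : V2 -> V3) (h : V1 -> V3) x v :
  differentiable f x -> differentiable g (f x) -> differentiable h x ->
  (\forall y \near x, h y = g (f y)) -> 'd h x v = 'd g (f x) ('d f x v).
Proof.
move=> df dg dh hE.
transitivity ('d (g \o f) x v); last by rewrite diff_comp.
rewrite -(deriveE v dh) -(deriveE v (differentiable_comp df dg)).
exact: near_eq_derive.
Qed.

Section Charts.
Context (R : realType) (n : nat) (M : smooth_manifold R n).
Implicit Types (a b c : chart R n M) (p : M).

Lemma transition_differentiable a b p : chart_at p a -> chart_at p b ->
  differentiable (b \o chart_inv a) (a p).
Proof.
move=> [Aa ap] [Ab bp]; apply: (atlas_smooth Aa Ab [::]).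
by exists p.
Qed.

(** The inverse chart is continuous relative to the image of the chart; as the image is open, it is
    continuous at each of its points. *)
Lemma chart_nbhs a b p : chart_at p a -> chart_at p b ->
  \forall x \near a p, (a @` chart_dom a) x /\ chart_dom b (chart_inv a x).
Proof.
move=> [Aa ap] [Ab bp]; have im : (a @` chart_dom a) (a p) by exists p.
have nim : nbhs (a p) (a @` chart_dom a).
  by apply: open_nbhs_nbhs; split => //; exact: chart_im_open.
have cont := @chart_inv_continuous _ _ _ a.
rewrite continuous_open_subspace in cont; last exact: chart_im_open.
have /cont cp : a p \in (a @` chart_dom a) by rewrite inE.
have nb : nbhs (chart_inv a (a p)) (chart_dom b).
  rewrite chart_mapK ?inE //.
  by apply: open_nbhs_nbhs; split => //; exact: chart_dom_open.
by apply: filterS2 nim (cp _ nb) => x.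
Qed.

(** The factorisation through [b] holds only near [a p], by [chart_nbhs]; the differential sees no
    more than that. *)
Lemma transition_comp a b c p (v : 'rV[R]_n) :
  chart_at p a -> chart_at p b -> chart_at p c ->
  'd (c \o chart_inv a) (a p) v =
  'd (c \o chart_inv b) (b p) ('d (b \o chart_inv a) (a p) v).
Proof.
move=> pa pb pc.
have bE : (b \o chart_inv a) (a p) = b p by rewrite /= chart_mapK // inE; case: pa.
have dab := transition_differentiable pa pb.
have dbc : differentiable (c \o chart_inv b) ((b \o chart_inv a) (a p)).
  by rewrite bE; exact: transition_differentiable.
have dac := transition_differentiable pa pc.
rewrite -bE; apply: near_diff_comp => //.
apply: filterS (chart_nbhs pa pb) => x [ax bx].
by rewrite /= chart_mapK // inE.
Qed.

Lemma chart_tvectorZ a (x v : 'rV[R]_n) (t : R) : atlas a -> (a @` chart_dom a) x ->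
  chart_tvector a (x, t *: v) = t *: chart_tvector a (x, v).
Proof.
move=> Aa [p ap <-]; apply/funext => b; rewrite /chart_tvector /=.
rewrite -[RHS]/(t *: (if _ then _ else _)).
by case: ifP => _; rewrite ?scaler0 // linearZ.
Qed.

(** Compatibility between two further charts is the cocycle rule [transition_comp]. Needed since the
    homogeneity of the metric is stated on tangent spaces. *)
Lemma chart_tvector_tangent a z : atlas a -> (a @` chart_dom a) z.1 ->
  tangent_space (chart_inv a z.1) (chart_tvector a z).
Proof.
case: z => x v /= Aa [p ap xE].
have pE : chart_inv a x = p by rewrite -xE chart_mapK // inE.
have pa : chart_at p a by [].
rewrite pE; split=> [b nb|b c pb pc]; rewrite /chart_tvector /= pE.
  by rewrite asboolF.
rewrite (asboolT pb) (asboolT pc) -xE; exact: transition_comp.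
Qed.

Lemma open_chart_slit a : open (chart_slit a).
Proof.
have -> : chart_slit a = (fst @^-1` (a @` chart_dom a)) `&` (snd @^-1` (~` [set 0])).
  by apply/seteqP; split => z [].
apply: openI; apply: open_comp.
- by move=> z _; exact: cvg_fst.
- exact: chart_im_open.
- by move=> z _; exact: cvg_snd.
- apply: closed_openC.
  exact/accessible_closed_set1/hausdorff_accessible/norm_hausdorff.
Qed.

Context (F : finsler_metric M).

Lemma Fsq_homogeneous a z (t : R) : atlas a -> chart_slit a z -> 0 < t ->
  Fsq (in_chart F a) (z.1, t *: z.2) = t ^+ 2 * Fsq (in_chart F a) z.
Proof.
move=> Aa [za _] t0; rewrite /Fsq /in_chart /= chart_tvectorZ // -surjective_pairing.
rewrite (metric_homogeneous F) //.
  by rewrite expr1z exprMn.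
exact: chart_tvector_tangent.
Qed.

(** Both sides are the derivative at $t=0$ of $E(x,(1+t)y)=(1+t)^2E(x,y)$. *)
Lemma Fsq_euler a z : atlas a -> chart_slit a z ->
  \sum_i z.2 0 i * dy i (Fsq (in_chart F a)) z = 2 * Fsq (in_chart F a) z.
Proof.
move=> Aa az; have Uo : open (chart_slit a) by exact: open_chart_slit.
have sF : smooth_on (chart_slit a) (in_chart F a) by exact: metric_smooth.
have sE : smooth_on (chart_slit a) (Fsq (in_chart F a)).
  by apply: smooth_ext (smoothM Uo sF sF).
rewrite (derive_fibre z.2 sE az).
have := @is_derive_line _ _ (Fsq (in_chart F a)) z (0, z.2) 0.
rewrite scale0r addr0 => /(_ (smooth_derivable sE az)) [_ <-].
pose f (t : R) := (1 + t) ^+ 2 * Fsq (in_chart F a) z.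
have -> : 'D_1 (fun t : R => Fsq (in_chart F a) (z + t *: (0, z.2))) 0 = 'D_1 f 0.
  apply: near_eq_derive.
  (* Homogeneity holds for positive factors only, whence $1+t>0$. *)
  have n0 : \forall t \near (0 : R), -1 < t by apply: lt_nbhsr; rewrite ltrN10.
  apply: filterS n0 => t t1; rewrite /f -Fsq_homogeneous //; last first.
    by rewrite -ltrBlDl sub0r.
  congr (Fsq _ _); case: (z) => x v /=.
  by congr pair; rewrite /= ?scaler0 ?addr0 // scalerDl scale1r.
have /@derive_val -> : is_derive (0 : R) 1 f (2 * Fsq (in_chart F a) z).
  set c := Fsq _ z.
  rewrite (_ : f = (cst 1 + id) ^+ 2 * cst c).
    apply: is_derive_eq; rewrite /GRing.scale /= !fctE /=. ring.
  by apply/funext.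
by [].
Qed.

End Charts.

Unset Implicit Arguments.

Theorem theorem3 (R : realType) (n : nat) (M : smooth_manifold R n)
    (F : finsler_metric M)
    (mu : M -> tvector M -> tvector M -> R) (lambda : M -> tvector M -> R)
    (mu_covector : covector_field mu)
    (mu_homogeneous : covector_homogeneous (-2) mu)
    (lambda_homogeneous :
       homogeneous_on (@slit_tangent_space R n M) (-1) lambda)
    (berwald_form : forall (a : chart R n M) (z : 'rV[R]_n * 'rV[R]_n),
       atlas a -> chart_slit a z -> forall i j k l : 'I_n,
       let h := fun s t => angular (in_chart F a) s t z in
       let hm := fun s t => angular_mixed (in_chart F a) s t z in
       let m := fun s => covector_comp mu a s z in
       berwald (in_chart F a) i j k l z =
         (m j * h k l + m k * h j l + m l * h j k) * z.2 0 i
         + in_chart lambda a z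
           * (hm i j * h k l + hm i k * h j l + hm i l * h j k)) :
  landsberg_vanishes F <-> mean_landsberg_vanishes F.
Proof.
split=> [L0 a z Aa az i|J0 a z Aa az].
  rewrite /mean_landsberg big1 // => j _; rewrite big1 // => k _.
  by rewrite L0 // mulr0.
have Uo : open (chart_slit a) by exact: open_chart_slit.
have sF : smooth_on (chart_slit a) (in_chart F a) by exact: metric_smooth.
have posdef w v := @metric_posdef _ _ _ F a w v Aa.
have eul w := @Fsq_euler _ _ _ F a w Aa.
pose q := Fsq (in_chart F a) z.
pose g s t := fund (in_chart F a) s t z.
pose gi s t := fund_inv (in_chart F a) s t z.
pose h s t := angular (in_chart F a) s t z.
pose hm s t := angular_mixed (in_chart F a) s t z.
pose m s := covector_comp mu a s z.
pose y s : R := z.2 0 s.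
pose yl s := ylow (in_chart F a) s z.
have g_sym i j : g i j = g j i by exact: (fund_sym Uo sF).
have giE i k : \sum_j gi i j * g j k = (i == k)%:R by exact: (fund_invE' posdef).
have gE i k : \sum_j g i j * gi j k = (i == k)%:R by exact: (fund_invE posdef).
have ylE i : yl i = \sum_j g i j * y j by [].
have qE : \sum_i y i * yl i = q by exact: (ylow_contract Uo sF eul).
(* $F^2=g_{ij}y^iy^j$ is positive because $y\neq0$ on the slit bundle. *)
have q0 : q != 0.
  have := posdef z z.2 az (proj2 az); rewrite -qE => /gt_eqF/negbT.
  rewrite (_ : \sum_i \sum_j _ = \sum_i y i * yl i) //.
  apply: eq_bigr => i _; rewrite ylE mulr_sumr; apply: eq_bigr => j _.
  by rewrite /g /y; ring.
have hE i j : h i j = g i j - q^-1 * yl i * yl j by [].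
have hmE i j : hm i j = (i == j)%:R - q^-1 * y i * yl j by [].
pose lam := in_chart lambda a z.
have LB j k l : landsberg (in_chart F a) j k l z =
    - 2^-1 * \sum_r yl r * ((m l * h j k + m j * h l k + m k * h l j) * y r
      + lam * (hm r l * h j k + hm r j * h l k + hm r k * h l j)).
  rewrite (landsbergE Uo sF posdef eul _ _ _ az); congr (_ * _).
  apply: eq_bigr => r _; congr (_ * _); exact: (berwald_form a z Aa az).
clearbody lam m.
have LE j k l : landsberg (in_chart F a) j k l z =
    - 2^-1 * q * (m l * h j k + m j * h l k + m k * h l j).
  rewrite LB -mulrA; congr (_ * _).
  exact: (angular_form_contract h m qE q0 hmE).
have c0 : - 2^-1 * q != 0 by rewrite mulf_neq0 // oppr_eq0 invr_eq0 pnatr_eq0.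
move=> j k l; rewrite LE (angular_form_eq0 g_sym giE gE ylE qE q0 hE) ?mulr0 // => i.
(* The trace of the cubic form, multiplied by $-\frac12F^2\neq0$, is $J_i$. *)
apply: (mulfI c0); rewrite mulr0 -[RHS](J0 a z Aa az i) /mean_landsberg mulr_sumr.
apply: eq_bigr => s _; rewrite mulr_sumr; apply: eq_bigr => t _.
by rewrite LE mulrCA.
Qed.
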